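(* Let $f:\mathcal{X}\to\mathbb{R}$ be a monotone, normalized function with submodularity ratio $\alpha$, and let $\mathcal{P}=conv(E)\subseteq\mathbb{R}^n_+$ with $E$ a finite nonempty set. Suppose that $|f(\bm{x})-f(\bm{y})|\le L\|\bm{x}-\bm{y}\|$ for all $\bm{x},\bm{y}\in Frontier(\mathcal{P})$, and that $\|\bm{x}\|\le D$ for all $\bm{x}\in\mathcal{P}$. Let $l$ be a positive integer, $\mathrm{OPT}=\max_{\bm{x}\in\mathcal{P}}f(\bm{x})$, and suppose that $\mathcal{E}=\{\frac1l\bm{x}:\bm{x}\in Frontier(E)\}$ is an orthogonal set (the inner product of any two distinct vectors of $\mathcal{E}$ is $0$). Then the LDGM-G algorithm with parameter $l$ outputs a point $\bm{x}\in\mathcal{P}$ with $$f(\bm{x})\ \ge\ \frac{\alpha}{2}(1-e^{-\alpha})\cdot\mathrm{OPT}-\frac{\alpha(1-e^{-\alpha})\,m\,D\,L}{2l},$$ where $m=|\mathcal{E}|\le|E|$.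
   Context: Notation: for vectors, $\bm{x}\le\bm{y}$ means $x_i\le y_i$ for all $i$, and $\bm{x}<\bm{y}$ means $\bm{x}\le\bm{y}$ and $x_i<y_i$ for some $i$. $\|\cdot\|$ is the Euclidean norm, $\langle\cdot,\cdot\rangle$ the standard inner product, $\bm{\chi}_i$ the $i$-th unit vector, $\mathbb{R}_+$ the non-negative reals, $[n]=\{1,\dots,n\}$. Functions: $\mathcal{X}=\prod_{i=1}^n\mathcal{X}_i$ with each $\mathcal{X}_i\subseteq\mathbb{R}_+$ compact. $f:\mathcal{X}\to\mathbb{R}$ is monotone if $\bm{x}\le\bm{y}$ implies $f(\bm{x})\le f(\bm{y})$, and normalized if $f(\bm{0})=0$. It is assumed that $\mathcal{X}$ contains every $\bm{z}$ with $\bm{0}\le\bm{z}\le\bm{p}$ for some $\bm{p}\in\mathcal{P}$ (so that $f$ is defined where needed). Submodularity ratio: $$\alpha=\inf_{\bm{x}\le\bm{y},\,k\in\mathbb{R}_+,\,i\in[n]:\,x_i=y_i}\frac{f(\bm{x}+k\bm{\chi}_i)-f(\bm{x})}{f(\bm{y}+k\bm{\chi}_i)-f(\bm{y})},$$ where all four points lie in $\mathcal{X}$ and choices with zero denominator are disregarded (with $\alpha=1$ if no choice remains). Frontier: for a set $S\subseteq\mathbb{R}^n_+$, $Frontier(S)=\{\bm{x}\in S:\ \nexists\,\bm{y}\in S,\ \bm{y}>\bm{x}\}$. LDGM-G algorithm (parameter $l$): set $\bm{x}_0=\bm{0}$, $t=0$, and let $\hat{\bm{x}}=l\hat{\bm{e}}$,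 where $\hat{\bm{e}}\in\arg\max_{\bm{e}\in\mathcal{E}}f(l\bm{e})$. Repeat: choose a pair $(\bm{e}^*,k)$ maximizing $\frac{f(\bm{x}_t+j\bm{e})-f(\bm{x}_t)}{j}$ over all $(\bm{e},j)$ with $\bm{e}\in\mathcal{E}$ and $j$ a positive integer with $j\le l-\frac{\langle\bm{x}_t,\bm{e}\rangle}{\langle\bm{e},\bm{e}\rangle}$ (ties broken arbitrarily). If $t+k>l$, set $\bm{x}_l=\bm{x}_t+(l-t)\bm{e}^*$ and return whichever of $\bm{x}_l,\hat{\bm{x}}$ has the larger $f$-value; otherwise set $\bm{x}_{t+k}=\bm{x}_t+k\bm{e}^*$, replace $t$ by $t+k$, and continue. If $t=l$ is reached, the algorithm returns whichever of $\bm{x}_l,\hat{\bm{x}}$ has the larger $f$-value.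
   Formalization: The formal theorem additionally assumes L ≥ 0; if Frontier(P) is a single point, a negative L satisfies the Lipschitz condition vacuously and the stated bound fails (e.g. n=1, f(x)=x, E={1}, l=1, D=1, L=−100). *)

(* Defs.v *)
From HB Require Import structures.
From mathcomp Require Export all_boot all_order all_algebra finmap.
From mathcomp Require Export all_classical all_reals all_analysis.
Export Order.TTheory GRing.Theory Num.Theory.
Export numFieldNormedType.Exports.

Set Implicit Arguments.
Unset Strict Implicit.
Unset Printing Implicit Defensive.

Local Open Scope classical_set_scope.
Local Open Scope ring_scope.

Section Vectors.
Variables (R : realType) (n : nat).
Implicit Types (x y : 'rV[R]_n) (S : set 'rV[R]_n).

Definition dot x y : R := \sum_(i < n) x 0 i * y 0 i.

(* The library's norm on 'rV[R]_n is the sup norm. *)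
Definition enorm x : R := Num.sqrt (dot x x).

Definition levec x y : Prop := forall i : 'I_n, x 0 i <= y 0 i.

(* Strict in at least one coordinate, not in all of them. *)
Definition ltvec x y : Prop := levec x y /\ exists i : 'I_n, x 0 i < y 0 i.

Definition unit_vec (i : 'I_n) : 'rV[R]_n := delta_mx 0 i.

Definition frontier S : set 'rV[R]_n :=
  [set x | S x /\ ~ exists y, S y /\ ltvec x y].

Definition conv S : set 'rV[R]_n :=
  [set x | exists (k : nat) (w : 'I_k -> R) (v : 'I_k -> 'rV[R]_n),
     [/\ forall j, 0 <= w j, \sum_(j < k) w j = 1, forall j, S (v j)
       & x = \sum_(j < k) w j *: v j]].

Definition prod_set (Xs : 'I_n -> set R) : set 'rV[R]_n :=
  [set x | forall i, Xs i (x 0 i)].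

Definition orthogonal_set S : Prop :=
  forall x y, S x -> S y -> x <> y -> dot x y = 0.

End Vectors.

(* A function X -> R is a total function on 'rV[R]_n whose values outside X
   are never constrained. *)
Section Functions.
Variables (R : realType) (n : nat).
Variables (X : set 'rV[R]_n) (f : 'rV[R]_n -> R).

Definition monotone_on : Prop :=
  forall x y, X x -> X y -> levec x y -> f x <= f y.

Definition submod_ratios : set R :=
  [set r | exists (x y : 'rV[R]_n) (k : R) (i : 'I_n),
     [/\ X x, X y, X (x + k *: unit_vec R i) & X (y + k *: unit_vec R i)] /\
     [/\ levec x y, 0 <= k, x 0 i = y 0 i,
         f (y + k *: unit_vec R i) - f y != 0
       & r = (f (x + k *: unit_vec R i) - f x)
             / (f (y + k *: unit_vec R i) - f y)]].

Definition submod_ratio : R :=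
  if `[< submod_ratios !=set0 >] then inf submod_ratios else 1.

End Functions.

Section LDGMG.
Variables (R : realType) (n : nat) (f : 'rV[R]_n -> R).
Variables (EE : set 'rV[R]_n) (l : nat).
Implicit Types (x e : 'rV[R]_n) (t j k : nat).

(* For e = 0 the quotient is 0 / 0 = 0, so that the bound reads j <= l. *)
Definition feasible_step x e j : Prop :=
  [/\ EE e, (0 < j)%N & j%:R <= l%:R - dot x e / dot e e].

Definition density x e j : R := (f (x + j%:R *: e) - f x) / j%:R.

Definition greedy_choice x e k : Prop :=
  feasible_step x e k /\
  forall e' j, feasible_step x e' j -> density x e' j <= density x e k.

(* [ldgmg_reach t x]: some run (some way of breaking ties) has x_t = x. *)
Inductive ldgmg_reach : nat -> 'rV[R]_n -> Prop :=
| ldgmg_init : ldgmg_reach 0 0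
| ldgmg_step t x e k :
    ldgmg_reach t x -> (t < l)%N -> greedy_choice x e k -> (t + k <= l)%N ->
    ldgmg_reach (t + k) (x + k%:R *: e).

(* [ldgmg_last x]: some run ends with x_l = x. *)
Inductive ldgmg_last : 'rV[R]_n -> Prop :=
| ldgmg_exact x : ldgmg_reach l x -> ldgmg_last x
| ldgmg_truncated t x e k :
    ldgmg_reach t x -> (t < l)%N -> greedy_choice x e k -> (l < t + k)%N ->
    ldgmg_last (x + (l - t)%:R *: e).

Definition best_single e : Prop :=
  EE e /\ forall e', EE e' -> f (l%:R *: e') <= f (l%:R *: e).

Definition larger_of x x' z : Prop :=
  (z = x /\ f x' <= f x) \/ (z = x' /\ f x <= f x').

Definition ldgmg_output z : Prop :=
  exists xl e, [/\ ldgmg_last xl, best_single e & larger_of xl (l%:R *: e) z].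

End LDGMG.

Definition scaled_frontier (R : realType) (n : nat)
    (E : set 'rV[R]_n) (l : nat) : set 'rV[R]_n :=
  [set l%:R^-1 *: x | x in frontier E].

(* Main.v *)
(* The vectors of Frontier(E) are nonnegative and pairwise orthogonal, hence
   have disjoint supports; so some convex combination p of them attains OPT, and
   the convex combinations of them form the frontier of P (unless E = {0}).
   Rounding the coefficients of p to multiples of 1/l gives x' = sum_j c_j e_j
   with sum_j c_j = l and f(x') >= OPT - m D L / l.  Since X is a product, it
   contains the box below sum_j l e_j, so joins of iterates with x' may be used
   although they need not lie below a point of P.  Raising the coefficients of
   x_t to those of x' direction by direction, the submodularity ratio and the
   greedy rule give alpha (f(x') - f(x_t)) <= l rho, where rho is the density of
   the step chosen; hence f(x_t) >= (1 - exp(-alpha t / l)) f(x').  If the last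
   step k is truncated, the full step would reach (1 - exp(-alpha)) f(x'), and
   alpha times its gain is at most f(l e* ), so alpha f(x_l) + f(l e^) is at
   least alpha (1 - exp(-alpha)) f(x'). *)
Require Import Defs.
From mathcomp Require Import ring lra zify.
Set Implicit Arguments.
Unset Strict Implicit.
Unset Printing Implicit Defensive.
Local Open Scope classical_set_scope.
Local Open Scope ring_scope.

(** * The submodularity ratio and vector increments *)

Section SubmodRatio.
Variables (R : realType) (n : nat) (X : set 'rV[R]_n) (f : 'rV[R]_n -> R).
Hypothesis fmono : monotone_on X f.
Implicit Types x y d : 'rV[R]_n.

Lemma levec_addr x d : levec 0 d -> levec x (x + d).
Proof. by move=> d0 i; rewrite mxE lerDl; have := d0 i; rewrite mxE. Qed.

Lemma levec_scale_unit (k : R) (i : 'I_n) :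
  0 <= k -> levec 0 (k *: unit_vec R i).
Proof. by move=> k0 j; rewrite !mxE mulr_ge0 // ler0n. Qed.

Lemma submod_ratios_ge0 r : submod_ratios X f r -> 0 <= r.
Proof.
move=> [x [y [k [i [[Xx Xy Xxk Xyk] [_ k0 _ _ ->]]]]]].
have ek := levec_scale_unit i k0.
by apply: divr_ge0; rewrite subr_ge0; apply: fmono => //; exact: levec_addr.
Qed.

Lemma submod_ratio_ge0 : 0 <= submod_ratio X f.
Proof.
rewrite /submod_ratio; case: asboolP => // ne.
by apply: lb_le_inf => // r; exact: submod_ratios_ge0.
Qed.

Lemma has_lbound_submod_ratios : has_lbound (submod_ratios X f).
Proof. by exists 0 => r; exact: submod_ratios_ge0. Qed.

(** Any admissible choice yields another one with both base points equal to [y], whose ratio is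
    1. *)
Lemma submod_ratio_le1 : submod_ratio X f <= 1.
Proof.
rewrite /submod_ratio; case: asboolP => // -[r].
move=> [x [y [k [i [[Xx Xy Xxk Xyk] [_ k0 _ dy0 _]]]]]].
apply: ge_inf; first exact: has_lbound_submod_ratios.
exists y, y, k, i; split; split => //; last by rewrite divff.
Qed.

(** The defining inequality with the division cleared. For a zero denominator it reduces to
    monotonicity; otherwise the quotient belongs to a set bounded below by 0, so the infimum lies
    below it. *)
Lemma submod_ratio_unit x y k i :
  X x -> X y -> X (x + k *: unit_vec R i) -> X (y + k *: unit_vec R i) ->
  levec x y -> 0 <= k -> x 0 i = y 0 i ->
  submod_ratio X f * (f (y + k *: unit_vec R i) - f y)
    <= f (x + k *: unit_vec R i) - f x.
Proof.
move=> Xx Xy Xxk Xyk xy k0 xyi.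
have ek := levec_scale_unit i k0.
have fxk : f x <= f (x + k *: unit_vec R i).
  by apply: fmono => //; exact: levec_addr.
have fyk : f y <= f (y + k *: unit_vec R i).
  by apply: fmono => //; exact: levec_addr.
have [dy0|dy0] := eqVneq (f (y + k *: unit_vec R i) - f y) 0.
  by rewrite dy0 mulr0 subr_ge0.
have ratio : submod_ratios X f ((f (x + k *: unit_vec R i) - f x)
                                / (f (y + k *: unit_vec R i) - f y)).
  by exists x, y, k, i.
rewrite -ler_pdivlMr ?lt_neqAle ?subr_ge0 ?fyk ?andbT 1?eq_sym//.
rewrite /submod_ratio; case: asboolP => [_|[]]; last by eexists; exact: ratio.
exact: ge_inf has_lbound_submod_ratios _ ratio.
Qed.

(* The increment is added one coordinate at a time. *)
Lemma submod_ratio_add x y d :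
  levec 0 x -> levec x y -> levec 0 d ->
  (forall i, d 0 i != 0 -> x 0 i = y 0 i) ->
  (forall z, levec 0 z -> levec z (y + d) -> X z) ->
  submod_ratio X f * (f (y + d) - f y) <= f (x + d) - f x.
Proof.
move=> x0 xy d0 dxy hX.
pose p (s : seq 'I_n) := \sum_(i <- s) d 0 i *: unit_vec R i.
have pE s i : uniq s -> p s 0 i = if i \in s then d 0 i else 0.
  rewrite /p; elim: s => [|j s IH] /=; first by rewrite big_nil mxE.
  case/andP=> js us; rewrite big_cons mxE (IH us) !mxE eqxx /= in_cons.
  have [->|ij] := eqVneq i j; last by rewrite mulr0 add0r.
  by rewrite (negPf js) mulr1 addr0.
have pd : p (enum 'I_n) = d.
  by apply/rowP => i; rewrite pE ?enum_uniq// mem_enum.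
have di i : 0 <= d 0 i by have := d0 i; rewrite mxE.
have xi i : 0 <= x 0 i by have := x0 i; rewrite mxE.
have xyi i : x 0 i <= y 0 i := xy i.
have Xp z s : uniq s -> levec 0 z -> levec z y -> X (z + p s).
  move=> us z0 zy; apply: hX => i; have := z0 i; have := zy i;
  have := di i; rewrite !mxE pE//; case: ifP; lra.
have y0 : levec 0 y by move=> i; apply: le_trans (x0 i) (xy i).
have yy : levec y y by move=> i.
suff H s : uniq s -> submod_ratio X f * (f (y + p s) - f y) <= f (x + p s) - f x.
  by rewrite -pd; apply: H; exact: enum_uniq.
elim: s => [_|i s IH us]; first by rewrite /p big_nil !addr0 !subrr mulr0.
have /= /andP[is_ us'] := us.
have psE z : z + p (i :: s) = (z + p s) + d 0 i *: unit_vec R i.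
  by rewrite /p big_cons addrA addrAC.
(* Agreement of [x] and [y] at [i] is assumed only on the support of [d]; off the support this step
   adds nothing. *)
have [d00|dn0] := eqVneq (d 0 i) 0.
  by rewrite !psE d00 scale0r !addr0; exact: IH.
have := IH us'.
have := @submod_ratio_unit (x + p s) (y + p s) (d 0 i) i.
rewrite -!psE => /(_ (Xp _ _ us' x0 xy) (Xp _ _ us' y0 yy)).
move=> /(_ (Xp _ _ us x0 xy) (Xp _ _ us y0 yy)) H.
have : submod_ratio X f * (f (y + p (i :: s)) - f (y + p s))
    <= f (x + p (i :: s)) - f (x + p s).
  apply: H => //; last by rewrite !mxE !pE// (negPf is_) !addr0; exact: dxy.
  by move=> j; rewrite !mxE lerD2r.
by rewrite !mulrBr; lra.
Qed.

End SubmodRatio.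

(** * Finite sets: indexing and maximization *)

(** Turns a finite set into an injective family over a [finType], so that sums over its elements
    become big operators. *)
Lemma finite_set_enum (T : choiceType) (A : set T) : finite_set A ->
  exists (I : finType) (v : I -> T),
    [/\ injective v, A = range v & #|I| = #|` fset_set A|%fset].
Proof.
move=> Afin; exists (fset_set A), val; split; first exact: val_inj.
  apply/seteqP; split => [x Ax|_ [x _ <-]].
    have xA : x \in fset_set A by rewrite in_fset_set// inE.
    by exists [` xA]%fset.
  by have := valP x; rewrite in_fset_set// inE.
by rewrite cardfE.
Qed.

Lemma finite_argmax (R : realType) (T : choiceType) (A : set T) (g : T -> R) :
  finite_set A -> A !=set0 -> exists2 x, A x & forall y, A y -> g y <= g x.
Proof.
move=> Afin [x0 Ax0]; have [I [v [_ vA _]]] := finite_set_enum Afin.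
move: Ax0; rewrite vA => -[i0 _ _].
case: (@arg_maxP _ R I i0 xpredT (g \o v) isT) => i _ imax.
by exists (v i); [exists i|move=> _ [j _ <-]; exact: imax].
Qed.

(** * Convex hulls, frontiers and rounding of weights *)

Section Convexity.
Variables (R : realType) (n : nat).
Implicit Types (E : set 'rV[R]_n) (x y : 'rV[R]_n).

Lemma conv_sum (I : finType) (w : I -> R) (v : I -> 'rV[R]_n) E :
  (forall j, 0 <= w j) -> \sum_j w j = 1 -> (forall j, E (v j)) ->
  conv E (\sum_j w j *: v j).
Proof.
move=> w0 w1 Ev; exists #|I|, (w \o enum_val), (v \o enum_val); split => //=.
- by rewrite -(big_enum_val w).
- by rewrite -(big_enum_val (fun j => w j *: v j)).
Qed.

Lemma sub_conv E x : E x -> conv E x.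
Proof.
move=> Ex; have -> : x = \sum_(i < 1) 1 *: x by rewrite big_ord1 scale1r.
by apply: (conv_sum (v := fun=> x)) => // ; rewrite big_ord1.
Qed.

(** Among the points of [E] above [x], one with the largest coordinate sum is maximal, since a
    strictly larger point has a strictly larger sum. *)
Lemma frontier_ge E x : finite_set E -> E x ->
  exists2 y, frontier E y & levec x y.
Proof.
move=> Efin Ex.
have [||y [Ey xy] ymax] :=
    @finite_argmax R _ (E `&` [set y | levec x y]) (fun y => \sum_i y 0 i).
- exact: finite_setIl.
- by exists x; split => // i.
exists y => //; split => // -[z [Ez [yz [i yzi]]]].
have := ymax z; rewrite leNgt => /(_ _)/negP; apply.
  by split=> // j; exact: le_trans (xy j) (yz j).
rewrite (bigD1 i)//= [ltRHS](bigD1 i)//=; apply: ltr_leD => //.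
by apply: ler_sum => j _; exact: yz.
Qed.

(** Each point of a convex combination is replaced by a frontier point above it; the weights sent to
    the same frontier point are then added up. *)
Lemma conv_le_frontier E (I : finType) (v : I -> 'rV[R]_n) y :
  finite_set E -> frontier E = range v -> conv E y ->
  exists u : I -> R, [/\ forall j, 0 <= u j, \sum_j u j = 1
    & levec y (\sum_j u j *: v j)].
Proof.
move=> Efin vE [k [w [z [w0 w1 Ez ->]]]].
have [phi phiP] : {phi : 'I_k -> I & forall j, levec (z j) (v (phi j))}.
  apply: (@choice _ _ (fun j i => levec (z j) (v i))) => j; have [y'] := frontier_ge Efin (Ez j).
  by rewrite vE => -[i _ <-] ?; exists i.
exists (fun j => \sum_(i | phi i == j) w i); split.
- by move=> j; exact: sumr_ge0.
- by rewrite -w1 [RHS](partition_big phi xpredT).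
have -> : \sum_j (\sum_(i | phi i == j) w i) *: v j = \sum_i w i *: v (phi i).
  rewrite [RHS](partition_big phi xpredT)//=; apply: eq_bigr => j _.
  by rewrite scaler_suml; apply: eq_bigr => i /eqP->.
move=> i; rewrite !summxE; apply: ler_sum => j _.
by rewrite !mxE ler_wpM2l//; exact: phiP.
Qed.

End Convexity.

(** All weights are rounded down, and then [l - s] of them are raised by one. There are enough
    indices for this because each truncation loses less than 1. *)
Lemma exists_rounding (R : realType) (I : finType) (w : I -> R) (l : nat) :
  (forall j, 0 <= w j) -> \sum_j w j = l%:R ->
  exists c : I -> nat, (\sum_j c j)%N = l /\ forall j, `|w j - (c j)%:R| <= 1.
Proof.
move=> w0 wl.
have tle j : (Num.truncn (w j))%:R <= w j by rewrite truncn_le.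
have tge j : w j < (Num.truncn (w j))%:R + 1.
  by have := truncnS_gt (w j); rewrite -natr1.
pose s := (\sum_j Num.truncn (w j))%N.
have sl : (s <= l)%N.
  by rewrite -(ler_nat R) -wl natr_sum; apply: ler_sum.
have lsI : (l - s <= #|I|)%N.
  rewrite leq_subLR -(ler_nat R) -wl natrD natr_sum -sum1_card natr_sum.
  by rewrite -big_split/=; apply: ler_sum => j _; apply: ltW; exact: tge.
pose A := [set j in take (l - s) (enum I)].
have cardA : #|A| = (l - s)%N.
  rewrite cardsE; have /card_uniqP -> := take_uniq (l - s) (enum_uniq I).
  by rewrite size_takel// -cardE.
exists (fun j => Num.truncn (w j) + (j \in A))%N; split.
  rewrite big_split/= -/s -[RHS](subnKC sl) -cardA -sum1_card; congr addn.
  by rewrite [RHS]big_mkcond; apply: eq_bigr => j _; case: (j \in A).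
move=> j; have := tle j; have := tge j; rewrite natrD ler_norml.
by case: (j \in A) => /=; lra.
Qed.

(** * Combinations of nonnegative orthogonal vectors *)

Section OrthogonalFamily.
Variables (R : realType) (n : nat) (I : finType) (e : I -> 'rV[R]_n).
Hypothesis e_ge0 : forall j, levec 0 (e j).
Hypothesis e_orth : forall j j', j != j' -> dot (e j) (e j') = 0.
Implicit Types (a b w : I -> R) (i : 'I_n) (j : I).

Definition lincomb a : 'rV[R]_n := \sum_j a j *: e j.

Lemma lincombE a i : lincomb a 0 i = \sum_j a j * e j 0 i.
Proof. by rewrite summxE; apply: eq_bigr => j _; rewrite mxE. Qed.

Lemma family_coord_ge0 j i : 0 <= e j 0 i.
Proof. by have := e_ge0 j i; rewrite mxE. Qed.

(** A vanishing sum of nonnegative products vanishes term by term. *)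
Lemma disjoint_supports j j' i : j != j' -> e j 0 i * e j' 0 i = 0.
Proof.
move=> /e_orth/psumr_eq0P; apply=> // k _.
by rewrite mulr_ge0// family_coord_ge0.
Qed.

Lemma lincomb_coord a j i : e j 0 i != 0 -> lincomb a 0 i = a j * e j 0 i.
Proof.
move=> eji; rewrite lincombE (bigD1 j)//= big1 ?addr0// => j' j'j.
have /eqP := disjoint_supports i j'j.
by rewrite mulf_eq0 (negPf eji) orbF => /eqP->; rewrite mulr0.
Qed.

Lemma dot_lincomb a j : dot (lincomb a) (e j) = a j * dot (e j) (e j).
Proof.
rewrite /dot mulr_sumr; apply: eq_bigr => i _.
have [->|eji] := eqVneq (e j 0 i) 0; first by rewrite !mulr0.
by rewrite (lincomb_coord a eji) mulrA.
Qed.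

Lemma dot_lincomb_self a :
  dot (lincomb a) (lincomb a) = \sum_j a j ^+ 2 * dot (e j) (e j).
Proof.
transitivity (\sum_j a j * dot (lincomb a) (e j)); last first.
  by apply: eq_bigr => j _; rewrite dot_lincomb mulrA expr2.
rewrite [LHS](_ : _ = \sum_i \sum_j lincomb a 0 i * (a j * e j 0 i)).
  rewrite exchange_big/=; apply: eq_bigr => j _.
  by rewrite mulr_sumr; apply: eq_bigr => i _; ring.
by apply: eq_bigr => i _; rewrite -mulr_sumr -lincombE.
Qed.

Lemma dot_ge0 (x : 'rV[R]_n) : 0 <= dot x x.
Proof. by apply: sumr_ge0 => i _; rewrite -expr2 sqr_ge0. Qed.

(** By orthogonality the squared norm is a sum of [#|I|] squares, each at most [K ^+ 2]; the crude
    bound m <= m^2 then allows taking the root. *)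
Lemma enorm_lincomb_le a (K : R) : 0 <= K ->
  (forall j, `|a j| * enorm (e j) <= K) -> enorm (lincomb a) <= #|I|%:R * K.
Proof.
move=> K0 aK; have mK0 : 0 <= #|I|%:R * K by rewrite mulr_ge0.
rewrite /enorm dot_lincomb_self -(ger0_norm mK0) -sqrtr_sqr ler_wsqrtr//.
apply: (@le_trans _ _ (\sum_(j : I) K ^+ 2)).
  apply: ler_sum => j _; rewrite -(sqr_sqrtr (dot_ge0 (e j))) -/(enorm (e j)).
  rewrite -[a j ^+ 2]real_normK ?num_real// -exprMn lerXn2r ?nnegrE//.
  by rewrite mulr_ge0// sqrtr_ge0.
rewrite sumr_const exprMn -[leLHS]mulr_natl ler_wpM2r ?sqr_ge0//.
by rewrite -natrX ler_nat; case: #|I| => // k; rewrite leq_pmulr.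
Qed.

Lemma lincomb_ge0 a : (forall j, 0 <= a j) -> levec 0 (lincomb a).
Proof.
move=> a0 i; rewrite lincombE mxE; apply: sumr_ge0 => j _.
by rewrite mulr_ge0// family_coord_ge0.
Qed.

Lemma le_lincomb a b : (forall j, a j <= b j) -> levec (lincomb a) (lincomb b).
Proof.
move=> ab i; rewrite !lincombE; apply: ler_sum => j _.
by rewrite ler_wpM2r// family_coord_ge0.
Qed.

(** At a coordinate where [e j] is positive, both combinations depend only on their [j]-th
    coefficient. *)
Lemma lincomb_leW a b j : e j != 0 -> levec (lincomb a) (lincomb b) ->
  a j <= b j.
Proof.
move=> ej0 ab; have /existsP[i eji] : [exists i, e j 0 i != 0].
  apply: contraNT ej0 => /existsPn ej0; apply/eqP/rowP => i.
  by rewrite mxE; have := ej0 i; rewrite negbK => /eqP.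
have := ab i; rewrite !(lincomb_coord _ eji) ler_pM2r//.
by rewrite lt_def eji family_coord_ge0.
Qed.

Lemma lincomb_le_eq a b : (forall j, e j != 0) -> \sum_j a j = \sum_j b j ->
  levec (lincomb a) (lincomb b) -> a =1 b.
Proof.
move=> e0 sab ab j; apply/eqP; rewrite eq_sym -subr_eq0; apply/eqP.
apply: (@psumr_eq0P _ _ xpredT (fun j => b j - a j)) => // [i _|].
  by rewrite subr_ge0; exact: lincomb_leW.
by rewrite sumrB sab subrr.
Qed.

(** A point [y] of the hull above [lincomb w] lies below a convex combination [lincomb u] of
    frontier points. Both coefficient sums are 1, so [w = u], and [y] cannot be strictly larger
    anywhere. *)
Lemma frontier_conv_lincomb E w : finite_set E -> frontier E = range e ->
  (forall j, e j != 0) -> (forall j, 0 <= w j) -> \sum_j w j = 1 ->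
  frontier (conv E) (lincomb w).
Proof.
move=> Efin fE e0 w0 w1; split.
  apply: conv_sum => // j.
  by have [] : frontier E (e j) by rewrite fE; exists j.
move=> [y [Ey [wy [i wyi]]]].
have [u [u0 u1 yu]] := conv_le_frontier Efin fE Ey.
have wu : w =1 u.
  apply: lincomb_le_eq => //; first by rewrite w1 u1.
  by move=> k; exact: le_trans (wy k) (yu k).
have := yu i; rewrite -/(lincomb u) leNgt => /negP; apply.
by rewrite (_ : lincomb u = lincomb w)//; apply: eq_bigr => j _; rewrite wu.
Qed.

End OrthogonalFamily.

(** * Runs of the algorithm as lattice points, and their existence *)

Section Greedy.
Variables (R : realType) (n : nat) (I : finType) (e : I -> 'rV[R]_n).
Hypothesis e_ge0 : forall j, levec 0 (e j).
Hypothesis e_orth : forall j j', j != j' -> dot (e j) (e j') = 0.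
Variables (f : 'rV[R]_n -> R) (l : nat).
Implicit Types (a b c : I -> nat) (j : I).

(** Every iterate has this form, and the sum of its natural coefficients is the time index [t]. *)
Definition lattice_point a : 'rV[R]_n := lincomb e (fun j => (a j)%:R).
Notation pt := lattice_point.

Lemma lattice_point0 : pt (fun=> 0%N) = 0.
Proof. by rewrite /lattice_point /lincomb big1// => j _; rewrite scale0r. Qed.

Lemma lattice_point_single j k : k%:R *: e j = pt (fun i => (i == j) * k)%N.
Proof.
rewrite /lattice_point /lincomb (bigD1 j)//= eqxx mul1n.
by rewrite big1 ?addr0// => i /negPf->; rewrite mul0n scale0r.
Qed.

Lemma lattice_point_add a j k :
  pt a + k%:R *: e j = pt (fun i => a i + (i == j) * k)%N.
Proof.
rewrite lattice_point_single.
rewrite /lattice_point /lincomb -big_split/=; apply: eq_bigr => i _.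
by rewrite natrD scalerDl.
Qed.

Lemma sum_add_single a j k :
  (\sum_i (a i + (i == j) * k) = \sum_i a i + k)%N.
Proof.
rewrite big_split/=; congr addn; rewrite (bigD1 j)//= eqxx mul1n.
by rewrite big1 ?addn0// => i /negPf->.
Qed.

Lemma ldgmg_reach_lattice t x : ldgmg_reach f (range e) l t x ->
  exists2 a, (\sum_j a j = t)%N & x = pt a.
Proof.
elim=> [|{}t {}x _ k _ [a at_ ->] _ [[[j _ <-] _ _] _] _].
  by exists (fun=> 0%N); rewrite ?lattice_point0// big1.
by exists (fun i => a i + (i == j) * k)%N;
  rewrite ?lattice_point_add// sum_add_single at_.
Qed.

Lemma ldgmg_last_lattice x : ldgmg_last f (range e) l x ->
  exists2 a, (\sum_j a j = l)%N & x = pt a.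
Proof.
case=> [{}x|t x' e' k]; first exact: ldgmg_reach_lattice.
move=> /ldgmg_reach_lattice[a at_ ->] tl [[[j _ <-] _ _] _] _.
exists (fun i => a i + (i == j) * (l - t))%N; rewrite ?lattice_point_add//.
by rewrite sum_add_single at_ subnKC// ltnW.
Qed.

Lemma coef_le_sum a j : (a j <= \sum_i a i)%N.
Proof. by rewrite (bigD1 j)//= leq_addr. Qed.

Lemma ge0_lattice_point a : levec 0 (pt a).
Proof. by apply: lincomb_ge0 => // j; rewrite ler0n. Qed.

(* The quotient is [a j], or [0] for [e j = 0]. *)
Lemma dot_quotient_bounds a j :
  0 <= dot (pt a) (e j) / dot (e j) (e j) <= (a j)%:R.
Proof.
rewrite dot_lincomb//; have [->|ne0] := eqVneq (dot (e j) (e j)) 0.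
  by rewrite mulr0 mul0r lexx ler0n.
by rewrite mulfK// lexx ler0n.
Qed.

(** There are finitely many candidates, since the subtracted quotient is nonnegative and so step
    lengths are at most [l]. A step of length 1 along [e j] is one of them because [a j < l]. *)
Lemma greedy_choice_exists a j : (\sum_i a i < l)%N ->
  exists e' k, greedy_choice f (range e) l (pt a) e' k.
Proof.
move=> al.
pose A := [set p : I * 'I_l.+1 | feasible_step (range e) l (pt a) (e p.1) p.2].
have kl e' k : feasible_step (range e) l (pt a) e' k -> (k < l.+1)%N.
  move=> [[j' _ <-] _]; have /andP[+ _] := dot_quotient_bounds a j'.
  by rewrite ltnS -(ler_nat R) => ? /le_trans; apply; rewrite gerBl.
have [||[j' k] /= Ap pmax] := @finite_argmax R _ A
    (fun p => density f (pt a) (e p.1) p.2).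
- exact: finite_finset.
- have l0 : (1 < l.+1)%N by rewrite ltnS; apply: leq_ltn_trans al.
  exists (j, Ordinal l0); split => //=; first by exists j.
  have /andP[_ qa] := dot_quotient_bounds a j.
  have : ((a j).+1%:R : R) <= l%:R.
    by rewrite ler_nat; exact: leq_ltn_trans (coef_le_sum a j) al.
  by rewrite -natr1; lra.
exists (e j'), k; split => // e1 k1 fk; have [[j1 _ E] _ _] := fk.
by rewrite -{}E in fk *; exact: (pmax (j1, Ordinal (kl _ _ fk)) fk).
Qed.

Lemma ldgmg_last_exists j : exists x, ldgmg_last f (range e) l x.
Proof.
(* Induction on a bound [d] for the remaining time, which every greedy step decreases; [j] only
   witnesses that there is a direction. *)
suff H d t x : (l - t <= d)%N -> (t <= l)%N ->
    ldgmg_reach f (range e) l t x -> exists y, ldgmg_last f (range e) l y.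
  exact: H (leqnn _) (leq0n _) (ldgmg_init _ _ _).
elim: d t x => [|d IH] t x td tl rx.
  have tE : t = l by lia.
  by exists x; apply: ldgmg_exact; rewrite -[X in ldgmg_reach _ _ _ X]tE.
have [tE|tl'] : t = l \/ (t < l)%N by lia.
  by exists x; apply: ldgmg_exact; rewrite -[X in ldgmg_reach _ _ _ X]tE.
have [a at_ xE] := ldgmg_reach_lattice rx.
have [|e' [k gk]] := @greedy_choice_exists a j; first by rewrite at_.
rewrite -xE in gk; have [[_ k0 _] _] := gk.
have [tkl|ltk] := leqP (t + k) l.
  by apply: IH (ldgmg_step rx tl' gk tkl) => //; lia.
by eexists; exact: ldgmg_truncated rx tl' gk ltk.
Qed.

(** * Progress of the greedy steps and quality of the output *)

Hypothesis e_neq0 : forall j, e j != 0.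
Variable X : set 'rV[R]_n.
Hypothesis fmono : monotone_on X f.
Hypothesis fnorm : f 0 = 0.
Hypothesis box_sub : forall z,
  levec 0 z -> levec z (pt (fun=> l)) -> X z.
Local Notation alpha := (submod_ratio X f).

Lemma lattice_point_in_box a : (forall j, a j <= l)%N -> X (pt a).
Proof.
move=> al; apply: box_sub; first exact: ge0_lattice_point.
by apply: le_lincomb => // j; rewrite ler_nat.
Qed.

Lemma le_lattice_point a b : (forall j, a j <= b j)%N -> (forall j, b j <= l)%N ->
  f (pt a) <= f (pt b).
Proof.
move=> ab bl; apply: fmono; first apply: lattice_point_in_box => j.
- exact: leq_trans (ab j) (bl j).
- exact: lattice_point_in_box.
- by apply: le_lincomb => // j; rewrite ler_nat.
Qed.

Lemma f_lattice_point_ge0 a : (forall j, a j <= l)%N -> 0 <= f (pt a).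
Proof.
by move=> al; rewrite -fnorm -lattice_point0; exact: le_lattice_point.
Qed.

Lemma single_coef_le j k : (k <= l)%N -> forall i, ((i == j) * k <= l)%N.
Proof. by move=> kl i; case: (i == j); lia. Qed.

Lemma add_single_le a j k : (forall i, a i <= l)%N -> (k + a j <= l)%N ->
  forall i, (a i + (i == j) * k <= l)%N.
Proof.
move=> al kl i; have := al i; case: eqP => [->|_]; rewrite ?mul1n; lia.
Qed.

(** For [e j] nonzero the quotient is exactly [a j], so feasibility says that the [j]-th coefficient
    stays at most [l]. *)
Lemma feasible_stepP a j k :
  feasible_step (range e) l (pt a) (e j) k <-> (0 < k)%N /\ (k + a j <= l)%N.
Proof.
have ne0 : dot (e j) (e j) != 0.
  apply: contra (e_neq0 j) => /eqP/psumr_eq0P ej0; apply/eqP/rowP => i.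
  apply/eqP; rewrite mxE -[_ == _]orbb -mulf_eq0; apply/eqP/ej0 => // ? _.
  by rewrite -expr2 sqr_ge0.
have E : (k%:R <= l%:R - dot (pt a) (e j) / dot (e j) (e j)) = (k + a j <= l)%N.
  by rewrite dot_lincomb// mulfK// lerBrDr -natrD ler_nat.
by split=> [[_ k0]|[k0 kl]]; rewrite ?E//; split; rewrite ?E//; exists j.
Qed.

Lemma greedy_density_ge0 a j k : (forall i, a i <= l)%N -> (0 < k)%N ->
  (k + a j <= l)%N -> 0 <= density f (pt a) (e j) k.
Proof.
move=> al k0 kl; rewrite divr_ge0 ?ler0n// subr_ge0 lattice_point_add.
apply: le_lattice_point => [i|]; first exact: leq_addr.
exact: add_single_le.
Qed.

(* Raising the coefficients of [pt a] to those of [pt c] direction by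
   direction costs at most [rho / alpha] per unit. *)
Lemma greedy_gain a c e' k : (forall i, a i <= l)%N -> (\sum_j c j = l)%N ->
  greedy_choice f (range e) l (pt a) e' k ->
  alpha * (f (pt c) - f (pt a)) <= l%:R * density f (pt a) e' k.
Proof.
move=> al cl [fk kmax]; have [[j0 _ e'E] _ _] := fk.
rewrite -{}e'E in fk kmax *.
have [k0 kl] := (feasible_stepP _ _ _).1 fk.
have rho0 := greedy_density_ge0 al k0 kl.
set rho := density _ _ _ _ in rho0 kmax *.
have cle j : (c j <= l)%N by rewrite -cl coef_le_sum.
(* For [c j <= a j] the truncated difference is 0 and nothing is added; otherwise [c j - a j] is a
   feasible length, at most [c j], and the greedy rule bounds its density by [rho]. *)
have step j : f (pt a + (c j - a j)%:R *: e j) - f (pt a) <= (c j)%:R * rho.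
  have [ca|ac] := leqP (c j) (a j).
    have /eqP-> : (c j - a j == 0)%N by rewrite subn_eq0.
    by rewrite scale0r addr0 subrr mulr_ge0// ler0n.
  have /kmax : feasible_step (range e) l (pt a) (e j) (c j - a j).
    by apply/feasible_stepP; have := cle j; lia.
  rewrite /density ler_pdivrMr ?ltr0n ?subn_gt0// => /le_trans; apply.
  by rewrite mulrC ler_wpM2r// ler_nat leq_subr.
(* [b s] is the maximum of [a] and [c] on the directions in [s], and [a] on the others. *)
pose b (s : seq I) := (fun i => a i + (i \in s) * (c i - a i))%N.
have bl s i : (b s i <= l)%N.
  by rewrite /b; have := al i; have := cle i; case: (i \in s); lia.
have H s : uniq s ->
    alpha * (f (pt (b s)) - f (pt a)) <= \sum_(j <- s) (c j)%:R * rho.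
  elim: s => [_|j s IH /= /andP[js us]].
    rewrite big_nil (_ : pt (b [::]) = pt a) ?subrr ?mulr0//.
    by apply: eq_bigr => i _; rewrite /b addn0.
  have bE : pt (b (j :: s)) = pt (b s) + (c j - a j)%:R *: e j.
    rewrite lattice_point_add; apply: eq_bigr => i _; rewrite /b in_cons.
    congr (_%:R *: _); have [->|_] := eqVneq i j; last by rewrite mul0n addn0.
    by rewrite (negPf js) !mul1n addn0.
  have Hadd : alpha * (f (pt (b (j :: s))) - f (pt (b s)))
      <= f (pt a + (c j - a j)%:R *: e j) - f (pt a).
    rewrite bE; apply: submod_ratio_add => //.
    - exact: ge0_lattice_point.
    - by apply: le_lincomb => // i; rewrite ler_nat leq_addr.
    - by move=> i; have := e_ge0 j i; rewrite !mxE; exact: mulr_ge0 (ler0n _ _).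
    (* On the support of [e j] only the [j]-th coefficient matters, and [b s] has not raised it, as
       [j] is not in [s]. *)
    - move=> i; rewrite mxE mulf_eq0 => /norP[_ eji].
      by rewrite !(lincomb_coord e_ge0 e_orth _ eji) /b ?(negPf js) ?addn0.
    - move=> z z0 zb; apply: box_sub => // i; apply: le_trans (zb i) _.
      rewrite -bE; apply: le_lincomb => // i'; rewrite ler_nat; exact: bl.
  rewrite big_cons; have := IH us; have := step j; move: Hadd.
  by rewrite !mulrBr; lra.
(* With all directions raised, the join dominates [pt c], and the bounds add up to [l * rho] because
   the coefficients of [c] sum to [l]. *)
have := H (enum I) (enum_uniq I).
rewrite big_enum/= -mulr_suml -natr_sum cl; apply: le_trans.
rewrite ler_wpM2l ?submod_ratio_ge0// lerB// le_lattice_point// => i.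
by rewrite /b mem_enum mul1n -leq_subLR.
Qed.

Lemma greedy_gap a c e' k : (forall i, a i <= l)%N -> (\sum_j c j = l)%N ->
  greedy_choice f (range e) l (pt a) e' k ->
  let gap t := expR (- (alpha * t%:R / l%:R)) * f (pt c) in
  forall t, f (pt c) - f (pt a) <= gap t ->
  f (pt c) - f (pt a + k%:R *: e') <= gap (t + k)%N.
Proof.
move=> al cl gk gap t.
have gain := greedy_gain al cl gk.
have [fk _] := gk; have [[j _ e'E] _ _] := fk; rewrite -{}e'E in gk gain fk *.
have [k0 kl] := (feasible_stepP _ _ _).1 fk.
have l0 : (0 < l)%N by apply: leq_trans kl; rewrite ltn_addr.
have k0R : 0 < k%:R :> R by rewrite ltr0n.
have l0R : 0 < l%:R :> R by rewrite ltr0n.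
have mono : f (pt a) <= f (pt a + k%:R *: e j).
  by have := greedy_density_ge0 al k0 kl; rewrite pmulr_lge0 ?invr_gt0// subr_ge0.
have cle i : (c i <= l)%N by rewrite -cl coef_le_sum.
have fc0 := f_lattice_point_ge0 cle.
set s := alpha * k%:R / l%:R.
have sgain : s * (f (pt c) - f (pt a)) <= f (pt a + k%:R *: e j) - f (pt a).
  have := ler_wpM2l (ltW (divr_gt0 k0R l0R)) gain.
  rewrite /density (_ : _ * (l%:R * _) = f (pt a + k%:R *: e j) - f (pt a)).
    by apply: le_trans; rewrite /s le_eqVlt; apply/orP; left; apply/eqP; ring.
  by field; rewrite !lt0r_neq0.
have gapD : gap (t + k)%N = expR (- s) * gap t.
  rewrite /gap mulrA -expRD; congr (expR _ * _); rewrite natrD /s.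
  by field; rewrite lt0r_neq0.
rewrite gapD => Gt.
(* A negative gap would reverse the comparison of 1 - s with exp(-s); monotonicity then keeps the
   gap negative, below a nonnegative bound. *)
have [G0|G0] := ltP (f (pt c) - f (pt a)) 0.
  have : 0 <= expR (- s) * gap t by rewrite !mulr_ge0 ?expR_ge0.
  lra.
have exps := expR_ge1Dx (- s).
have : (1 - s) * (f (pt c) - f (pt a)) <= expR (- s) * (f (pt c) - f (pt a)).
  exact: ler_wpM2r.
have : expR (- s) * (f (pt c) - f (pt a)) <= expR (- s) * gap t.
  by rewrite ler_wpM2l// expR_ge0.
by rewrite mulrBl mul1r; lra.
Qed.

Lemma ldgmg_reach_gap c t x : (\sum_j c j = l)%N ->
  ldgmg_reach f (range e) l t x ->
  f (pt c) - f x <= expR (- (alpha * t%:R / l%:R)) * f (pt c).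
Proof.
move=> cl; elim=> [|{}t {}x e' k rx IH tl gk _].
  by rewrite mulr0 mul0r oppr0 expR0 mul1r fnorm subr0.
have [a at_ xE] := ldgmg_reach_lattice rx; rewrite {}xE in IH gk *.
apply: greedy_gap => // i.
by rewrite (leq_trans (coef_le_sum a i))// at_ ltnW.
Qed.

(** The component [a j] times [e j] lies below [pt a] and agrees with it on the support of [e j], so
    the ratio transfers the increment to it. Nonnegativity and monotonicity of [f] along [e j]
    finish. *)
Lemma overshoot_gain a j k : (forall i, a i <= l)%N -> (k + a j <= l)%N ->
  alpha * (f (pt a + k%:R *: e j) - f (pt a)) <= f (l%:R *: e j).
Proof.
move=> al kl.
have ptj := lattice_point_single j.
have H : alpha * (f (pt a + k%:R *: e j) - f (pt a))
    <= f ((a j)%:R *: e j + k%:R *: e j) - f ((a j)%:R *: e j).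
  apply: submod_ratio_add => //.
  - by rewrite ptj; exact: ge0_lattice_point.
  - rewrite ptj; apply: le_lincomb => // i; rewrite ler_nat.
    by case: eqP => [->|_]; rewrite ?mul1n.
  - by rewrite ptj; exact: ge0_lattice_point.
  - move=> i; rewrite [_ 0 i]mxE mulf_eq0 => /norP[_ eji].
    by rewrite mxE (lincomb_coord e_ge0 e_orth _ eji).
  - rewrite lattice_point_add => z z0 zb; apply: box_sub => // i.
    apply: le_trans (zb i) _; apply: le_lincomb => // i'; rewrite ler_nat.
    exact: add_single_le.
apply: le_trans H _.
have : 0 <= f ((a j)%:R *: e j).
  by rewrite ptj f_lattice_point_ge0//; exact: single_coef_le.
have : f ((a j)%:R *: e j + k%:R *: e j) <= f (l%:R *: e j).
  rewrite -scalerDl -natrD !ptj le_lattice_point// => [i|]; last exact: single_coef_le.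
  by rewrite leq_mul2l addnC kl orbT.
lra.
Qed.

Lemma ldgmg_output_ge c z : (\sum_j c j = l)%N -> (0 < l)%N ->
  ldgmg_output f (range e) l z ->
  alpha / 2 * (1 - expR (- alpha)) * f (pt c) <= f z.
Proof.
move=> cl l0 [xl [eh [lastx [[j0 _ <-] best]] out]].
have cle i : (c i <= l)%N by rewrite -cl coef_le_sum.
have fc0 := f_lattice_point_ge0 cle.
have a0 := submod_ratio_ge0 fmono; have a1 := submod_ratio_le1 fmono.
set q := 1 - expR (- alpha).
have q0 : 0 <= q by rewrite subr_ge0 -[leRHS]expR0 ler_expR oppr_le0.
have qf0 : 0 <= q * f (pt c) by rewrite mulr_ge0.
have fzx : f xl <= f z by case: out => -[->].
have fzh : f (l%:R *: e j0) <= f z by case: out => -[->].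
have gap_l : expR (- (alpha * l%:R / l%:R)) * f (pt c) = f (pt c) - q * f (pt c).
  by rewrite mulfK ?pnatr_eq0 -?lt0n// /q; ring.
have aqf : alpha * (q * f (pt c)) <= q * f (pt c) by rewrite ler_piMl.
(* The returned value is at least the average of the two candidates, whence the factor 1/2. *)
suff : alpha * (q * f (pt c)) <= f xl + f (l%:R *: e j0) by lra.
case: lastx fzx => [x rx _|t x e' k rx tl gk ltk _].
  have := ldgmg_reach_gap cl rx; rewrite gap_l.
  suff : 0 <= f (l%:R *: e j0) by lra.
  by rewrite lattice_point_single f_lattice_point_ge0//; exact: single_coef_le.
have gap := ldgmg_reach_gap cl rx.
have [a at_ xE] := ldgmg_reach_lattice rx; rewrite {}xE in gap gk *.
have al i : (a i <= l)%N by rewrite (leq_trans (coef_le_sum a i))// at_ ltnW.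
have := greedy_gap al cl gk gap.
have [fk _] := gk; have [[j _ e'E] _ _] := fk; rewrite -{}e'E in gk fk *.
have [k0 kl] := (feasible_stepP _ _ _).1 fk.
move=> gap'.
have over := overshoot_gain al kl.
have hat := best _ (ex_intro2 _ _ j Logic.I erefl).
have : f (pt a) <= f (pt a + (l - t)%:R *: e j).
  rewrite lattice_point_add le_lattice_point// => [i|]; first exact: leq_addr.
  by apply: add_single_le => //; lia.
(* As [l < t + k], the bound after the full step is at least as good as the one at time [l]. *)
have : expR (- (alpha * (t + k)%:R / l%:R)) * f (pt c) <= f (pt c) - q * f (pt c).
  rewrite -gap_l ler_wpM2r// ler_expR lerN2 ler_wpM2r ?invr_ge0 ?ler0n//.
  by rewrite ler_wpM2l// ler_nat ltnW.
have fa0 := f_lattice_point_ge0 al.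
have afa : alpha * f (pt a) <= f (pt a) by rewrite ler_piMl.
set fk' := f (pt a + k%:R *: e j) in gap' over *.
move=> h1 h2.
(* The full step reaches [q * f (pt c)]; by [over], alpha times its value is at most
   [alpha * f (pt a)] plus the value of a single direction, and these are bounded by [f xl] and the
   best single value. *)
have : alpha * (q * f (pt c)) <= alpha * fk' by rewrite ler_wpM2l//; lra.
by move: over; rewrite mulrBr; lra.
Qed.

End Greedy.

(** * The degenerate case and the approximation guarantee *)

Lemma card_scaled_frontier (R : realType) (n : nat) (E : set 'rV[R]_n) (l : nat) :
  finite_set E ->
  (#|` fset_set (scaled_frontier E l)| <= #|` fset_set E|)%fset%N.
Proof.
move=> Efin; have fE : frontier E `<=` E by move=> x [].
have fEfin := sub_finite_set fE Efin.
rewrite fset_set_image// (leq_trans (leq_imfset_card _ _ _))//.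
by rewrite fsubset_leq_card// -fset_set_sub.
Qed.

(** Any other nonnegative point would dominate 0. This settles the case of a zero direction, which
    the greedy analysis excludes. *)
Lemma frontier0_eq (R : realType) (n : nat) (E : set 'rV[R]_n) :
  (forall x, E x -> levec 0 x) -> frontier E 0 -> E = [set 0].
Proof.
move=> E0 [E00 max0]; apply/seteqP; split => [x Ex|_ ->//].
apply/rowP => i; apply/eqP; rewrite eq_le; have := E0 _ Ex i => ->.
rewrite andbT leNgt; apply/negP => x0; apply: max0.
by exists x; split => //; split; [exact: E0|exists i].
Qed.

Lemma conv_set0 (R : realType) (n : nat) (x : 'rV[R]_n) :
  conv [set 0] x -> x = 0.
Proof.
by move=> [k [w [v [_ _ v0 ->]]]]; rewrite big1// => j _; rewrite v0 scaler0.
Qed.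

Theorem theorem2 (R : realType) (n : nat)
  (Xs : 'I_n -> set R)
  (hXs : forall i, compact (Xs i) /\ (forall r, Xs i r -> 0 <= r))
  (f : 'rV[R]_n -> R)
  (fmono : monotone_on (prod_set Xs) f)
  (fnorm : f 0 = 0)
  (alpha : R) (halpha : alpha = submod_ratio (prod_set Xs) f)
  (E : set 'rV[R]_n) (Efin : finite_set E) (Ene : E !=set0)
  (Ppos : forall x, conv E x -> levec 0 x)
  (hdom : forall p z, conv E p -> levec 0 z -> levec z p -> prod_set Xs z)
  (L D : R) (L_ge0 : 0 <= L)
  (fLip : forall x y, frontier (conv E) x -> frontier (conv E) y ->
     `|f x - f y| <= L * enorm (x - y))
  (hD : forall x, conv E x -> enorm x <= D)
  (l : nat) (l_gt0 : (0 < l)%N)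
  (OPT : R) (OPT_attained : (f @` conv E) OPT)
  (OPT_ub : ubound (f @` conv E) OPT)
  (orthE : orthogonal_set (scaled_frontier E l))
  (m : nat) (hm : m = #|` fset_set (scaled_frontier E l)|%fset) :
  [/\ (m <= #|` fset_set E|%fset)%N,
      exists x, ldgmg_output f (scaled_frontier E l) l x
    & forall x, ldgmg_output f (scaled_frontier E l) l x ->
        conv E x /\
        f x >= alpha / 2 * (1 - expR (- alpha)) * OPT
               - alpha * (1 - expR (- alpha)) * m%:R * D * L / (2 * l%:R)].
Proof.
have l0 : l%:R != 0 :> R by rewrite pnatr_eq0 -lt0n.
have lR : 0 < l%:R :> R by rewrite ltr0n.
have fEfin : finite_set (frontier E) by apply: sub_finite_set Efin => x [].
have mE := card_scaled_frontier l Efin; rewrite -hm in mE.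
have [I [e [e_inj eE eI]]] := finite_set_enum (finite_image _ fEfin :
  finite_set (scaled_frontier E l)).
rewrite -hm in eI; rewrite eE in orthE *.
(* The [v j] are the points of Frontier(E) themselves; dividing lattice coefficients of sum [l] by
   [l] gives convex weights on them. *)
pose v j := l%:R *: e j.
have vE : frontier E = range v.
  apply/seteqP; split => [x fx|_ [j _ <-]].
    have : scaled_frontier E l (l%:R^-1 *: x) by exists x.
    by rewrite eE => -[j _ ej]; exists j => //; rewrite /v ej scalerA divff// scale1r.
  have : range e (e j) by exists j.
  by rewrite -eE => -[x fx ej]; rewrite /v -ej scalerA divff// scale1r.
have Ev j : E (v j) by have [] : frontier E (v j) by rewrite vE; exists j.
have Cv j : conv E (v j) := sub_conv (Ev j).
have v_ge0 j : levec 0 (v j) := Ppos _ (Cv j).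
have e_ge0 j : levec 0 (e j).
  by move=> i; have := v_ge0 j i; rewrite !mxE pmulr_rge0.
have e_orth j j' : j != j' -> dot (e j) (e j') = 0.
  move=> jj'; apply: orthE; [by exists j|by exists j'|].
  by move=> /e_inj/eqP; apply/negP.
have v_orth j j' : j != j' -> dot (v j) (v j') = 0.
  move=> /e_orth ejj'; rewrite -[RHS](mulr0 (l%:R ^+ 2)) -ejj' /dot mulr_sumr.
  by apply: eq_bigr => i _; rewrite !mxE; ring.
have ptv a : lattice_point e a = lincomb v (fun j => (a j)%:R / l%:R).
  by apply: eq_bigr => j _; rewrite scalerA mulfVK.
have sumdiv (a : I -> nat) : (\sum_j a j = l)%N -> \sum_j (a j)%:R / l%:R = 1 :> R.
  by move=> al; rewrite -mulr_suml -natr_sum al divff.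
have conv_pt a : (\sum_j a j = l)%N -> conv E (lattice_point e a).
  by move=> al; rewrite ptv; apply: conv_sum => //; exact: sumdiv.
have [x0 Ex0] := Ene.
have [y0 fy0 _] := frontier_ge Efin Ex0.
have [j0 _ _] : range v y0 by rewrite -vE.
split => //.
  have [xl lastx] := ldgmg_last_exists e_ge0 e_orth f l j0.
  have [||eh EEeh best] := @finite_argmax R _ (range e) (fun y => f (l%:R *: y)).
  - by rewrite -eE; exact: finite_image.
  - by exists (e j0); exists j0.
  have [le|le] := leP (f xl) (f (l%:R *: eh)).
    by exists (l%:R *: eh), xl, eh; split => //; right.
  by exists xl, xl, eh; split => //; left; rewrite (ltW le).
move=> z outz.
have Cz : conv E z.
  have [xl [eh [lastx [[j _ <-] _] out]]] := outz.
  have [a al xE] := ldgmg_last_lattice lastx.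
  by case: out => -[-> _]; [rewrite xE; exact: conv_pt|exact: Cv].
split => //.
have a0 := submod_ratio_ge0 fmono; rewrite -halpha in a0.
have q0 : 0 <= 1 - expR (- alpha).
  by rewrite subr_ge0 -[leRHS]expR0 ler_expR oppr_le0.
set q := 1 - expR (- alpha) in q0 *.
have D0 : 0 <= D by apply: le_trans (hD _ (Cv j0)); exact: sqrtr_ge0.
have K0 : 0 <= alpha / 2 * q by rewrite mulr_ge0// divr_ge0.
(* Rounding moves each of the [m] weights by at most 1/l, along a vector of norm at most [D]. *)
pose err := L * (m%:R * (D / l%:R)).
have err0 : 0 <= err by rewrite !mulr_ge0// invr_ge0 ltW.
have -> : alpha * q * m%:R * D * L / (2 * l%:R) = alpha / 2 * q * err.
  by rewrite /err; field.
have [p Cp fp] := OPT_attained.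
(* A zero direction forces E = {0}; then the hull is {0} and OPT = f(0) = 0. *)
have [/existsP[j /eqP ej0]|/existsPn e_neq0] := boolP [exists j, e j == 0].
  have E0 : E = [set 0].
    apply: frontier0_eq; first by move=> x /sub_conv/Ppos.
    by rewrite vE; exists j => //; rewrite /v ej0 scaler0.
  rewrite -fp; rewrite E0 in Cp Cz; rewrite (conv_set0 Cp) (conv_set0 Cz) fnorm.
  by rewrite mulr0 sub0r oppr_le0 mulr_ge0.
have v_neq0 j : v j != 0 by rewrite scaler_eq0 negb_or l0 e_neq0.
have [w [w0 w1 pw]] := conv_le_frontier Efin vE Cp.
rewrite -/(lincomb v w) in pw.
have [c [cl cw]] : exists c : I -> nat, (\sum_j c j)%N = l /\
    forall j, `|l%:R * w j - (c j)%:R| <= 1.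
  apply: exists_rounding; first by move=> j; rewrite mulr_ge0.
  by rewrite -mulr_sumr w1 mulr1.
have fw : frontier (conv E) (lincomb v w) by exact: frontier_conv_lincomb.
have fc : frontier (conv E) (lattice_point e c).
  rewrite ptv; apply: frontier_conv_lincomb => //; exact: sumdiv.
have Cw := fw.1.
have OPTw : OPT <= f (lincomb v w).
  rewrite -fp; apply: fmono => //; apply: (hdom _ _ Cw) => //; exact: Ppos.
(* The Lipschitz bound applies because the optimal combination and its rounding both lie on the
   frontier of the hull. *)
have wc : f (lincomb v w) - f (lattice_point e c) <= err.
  apply: le_trans (ler_norm _) _; apply: le_trans (fLip _ _ fw fc) _.
  rewrite ler_wpM2l// ptv.
  have -> : lincomb v w - lincomb v (fun j => (c j)%:R / l%:R)
      = lincomb v (fun j => w j - (c j)%:R / l%:R).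
    by rewrite /lincomb -sumrB; apply: eq_bigr => j _; rewrite scalerBl.
  rewrite -eI; apply: enorm_lincomb_le => // [|j]; first by rewrite divr_ge0// ltW.
  rewrite mulrC ler_pM ?sqrtr_ge0 ?normr_ge0//; first exact: hD.
  rewrite -(ler_pM2l lR) divff// -[X in X * _](gtr0_norm lR) -normrM mulrBr.
  by rewrite mulrCA divff// mulr1; exact: cw.
(* [X] is a product, so each coordinate is checked separately. If [e j] is positive at [i], then
   [z' 0 i] times the unit vector lies below [v j], a point of the hull; if no direction is, then
   [z' 0 i = 0], a coordinate of the zero vector. *)
have box z' : levec 0 z' -> levec z' (lattice_point e (fun=> l)) -> prod_set Xs z'.
  move=> z'0 z'l i.
  have [/existsP[j eji]|/existsPn eji] := boolP [exists j, e j 0 i != 0].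
    have := z'l i; rewrite (lincomb_coord e_ge0 e_orth _ eji) => z'i.
    have -> : z' 0 i = (z' 0 i *: unit_vec R i) 0 i by rewrite !mxE !eqxx mulr1.
    apply: (hdom _ _ (Cv j)) => i'; rewrite !mxE /=.
      by rewrite mulr_ge0//; have := z'0 i; rewrite mxE.
    case: eqP => [->|_]; first by rewrite mulr1.
    by rewrite mulr0 mulr_ge0//; have := e_ge0 j i'; rewrite mxE.
  have -> : z' 0 i = (0 : 'rV[R]_n) 0 i.
    apply/le_anti; rewrite z'0 andbT mxE; apply: le_trans (z'l i) _.
    rewrite lincombE big1// => j _.
    by have := eji j; rewrite negbK => /eqP->; rewrite mulr0.
  by apply: (hdom _ _ Cp) => //; exact: Ppos.
have := ldgmg_output_ge e_ge0 e_orth e_neq0 fmono fnorm box cl l_gt0 outz.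
rewrite -halpha -/q; apply: le_trans; rewrite -mulrBr ler_wpM2l//; lra.
Qed.
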